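(* The halved Farey graph $\breve F$ is infinitely edge-connected and is strongly immersed in every infinitely edge-connected graph. Moreover, up to immersion equivalence it is the unique such graph: if $H$ is an infinitely edge-connected graph that is strongly immersed in every infinitely edge-connected graph, then $H$ and $\breve F$ are each strongly immersed in the other.
   Context: All graphs are simple. A graph $G$ (with at least two vertices) is infinitely edge-connected if no two vertices of $G$ can be separated by deleting finitely many edges. A strong immersion of a graph $H$ in a graph $G$ is a map $\alpha$ with domain $V(H)\sqcup E(H)$ that embeds $V(H)$ injectively into $V(G)$ and sends every edge $uv\in E(H)$ to an $\alpha(u)$--$\alpha(v)$ path in $G$, such that these paths are pairwise edge-disjoint and no path $\alpha(e)$ has an internal vertex in $\alpha[V(H)]$. $H$ is (strongly) immersed in $G$ if such a map exists; two graphs are immersion-equivalent if each is immersed in the other. The halved Farey graph: $\breve F_0$ is a $K^2$ whose edge is coloured blue; $\breve F_{n+1}$ is obtained from $\breve F_n$ by adding, for every blue edge $e$ of $\breve F_n$, a new vertex $v_e$ joined by two blue edges exactly to the endvertices of $e$, and recolouring all edges of $\breve F_n$ black. The halved Farey graph is $\breve F=\bigcup_{n\in\mathbb N}\breve F_n$ (forgetting colours). *)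

(* Defs.v *)
From Stdlib Require Import List Arith Lia.
Import ListNotations.

Record graph : Type := Graph {
  vertex :> Type;
  adj : vertex -> vertex -> Prop;
  adj_sym : forall x y, adj x y -> adj y x;
  adj_irrefl : forall x, ~ adj x x
}.

Arguments adj : clear implicits.

(* A finite path is given by the list of its vertices in order, so that its
   edges are the pairs of consecutive entries. *)
Definition path_steps {V : Type} (p : list V) : list (V * V) :=
  combine p (tl p).

Definition uses_edge {V : Type} (p : list V) (x y : V) : Prop :=
  In (x, y) (path_steps p) \/ In (y, x) (path_steps p).

(* The default value of [last] is irrelevant: the first clause makes [p]
   nonempty. *)
Definition is_path (G : graph) (u v : G) (p : list G) : Prop :=
  hd_error p = Some u /\ last p u = v /\ NoDup p /\
  forall x y, In (x, y) (path_steps p) -> adj G x y.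

(* [S] lists edges as ordered pairs; both orientations are deleted, and pairs
   that are not edges of [G] have no effect. *)
Definition delete_edges (G : graph) (S : list (G * G)) : graph.
Proof.
  refine (Graph G (fun x y => adj G x y /\ ~ In (x, y) S /\ ~ In (y, x) S) _ _).
  - intros x y (Hxy & H1 & H2); auto using adj_sym.
  - intros x (Hxx & _); exact (adj_irrefl G x Hxx).
Defined.

Definition infinitely_edge_connected (G : graph) : Prop :=
  (exists u v : G, u <> v) /\
  forall u v : G, u <> v ->
  forall S : list (G * G), exists p, is_path (delete_edges G S) u v p.

(* The edge part of an immersion is a function [pth] of ordered pairs, of which
   only the values at adjacent pairs matter; [si_rev] says that the two
   orientations of an edge of [H] are sent to the same path of [G], traversed
   in opposite directions. *)
Record is_strong_immersion (H G : graph)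
    (f : H -> G) (pth : H -> H -> list G) : Prop := {
  si_inj : forall x y, f x = f y -> x = y;
  si_path : forall u v, adj H u v -> is_path G (f u) (f v) (pth u v);
  si_rev : forall u v, adj H u v -> pth v u = rev (pth u v);
  si_edge_disjoint : forall u v u' v',
    adj H u v -> adj H u' v' ->
    ~ (u = u' /\ v = v') -> ~ (u = v' /\ v = u') ->
    forall a b, ~ (uses_edge (pth u v) a b /\ uses_edge (pth u' v') a b);
  si_internal : forall u v, adj H u v ->
    forall z, In z (pth u v) -> z <> f u -> z <> f v -> forall x, z <> f x
}.

Definition strongly_immersed (H G : graph) : Prop :=
  exists f pth, is_strong_immersion H G f pth.

Definition immersion_equivalent (H G : graph) : Prop :=
  strongly_immersed H G /\ strongly_immersed G H.

(* Names for the vertices of the halved Farey graph: [base false] and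
   [base true] are the two vertices of the initial K^2, and [apex x y] is the
   vertex v_e added for the blue edge e = xy. *)
Inductive label : Type :=
| base (b : bool)
| apex (x y : label).

(* Each edge is recorded once, as an ordered pair; the orientation is only used
   to give v_e a single name, see [blue_oriented]. *)
Record coloured_graph : Type := ColouredGraph {
  verts : label -> Prop;
  blue : label -> label -> Prop;
  black : label -> label -> Prop
}.

Definition farey_init : coloured_graph := {|
  verts x := exists b, x = base b;
  blue x y := x = base false /\ y = base true;
  black _ _ := False
|}.

Definition farey_step (F : coloured_graph) : coloured_graph := {|
  verts z := verts F z \/ exists x y, blue F x y /\ z = apex x y;
  blue a z := exists x y, blue F x y /\ z = apex x y /\ (a = x \/ a = y);
  black x y := black F x y \/ blue F x y
|}.

Fixpoint halved_farey_stage (n : nat) : coloured_graph :=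
  match n with
  | 0 => farey_init
  | S n => farey_step (halved_farey_stage n)
  end.

Fixpoint height (x : label) : nat :=
  match x with
  | base _ => 0
  | apex x y => S (max (height x) (height y))
  end.

Lemma height_verts n x : verts (halved_farey_stage n) x -> height x <= n
with height_blue n x y : blue (halved_farey_stage n) x y ->
  verts (halved_farey_stage n) x /\ verts (halved_farey_stage n) y /\
  height (apex x y) = S n.
Proof.
  - destruct n as [|n]; simpl.
    + intros [b ->]; simpl; lia.
    + intros [H | (a & b & H & ->)].
      * apply height_verts in H; lia.
      * apply height_blue in H; destruct H as (_ & _ & H); lia.
  - destruct n as [|n].
    + intros [-> ->]; simpl; eauto.
    + intros (a & b & H & -> & E).
      assert (K := H); apply height_blue in K; destruct K as (Ha & Hb & Hh).
      assert (La := height_verts _ _ Ha); assert (Lb := height_verts _ _ Hb).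
      split; [|split].
      * left; destruct E as [-> | ->]; assumption.
      * right; eauto.
      * cbn [height] in *; destruct E as [-> | ->]; lia.
Qed.

(* The vertices v_e are new. *)
Lemma apex_fresh n x y :
  blue (halved_farey_stage n) x y -> ~ verts (halved_farey_stage n) (apex x y).
Proof.
  intros H K; apply height_blue in H; destruct H as (_ & _ & H).
  apply height_verts in K; lia.
Qed.

(* No blue edge is recorded in both orientations, so v_e is unique. *)
Lemma blue_oriented n x y :
  blue (halved_farey_stage n) x y -> ~ blue (halved_farey_stage n) y x.
Proof.
  destruct n as [|n].
  - intros [-> ->] [E _]; discriminate.
  - intros (a & b & H & -> & E) (c & d & K & -> & E').
    apply height_blue in H, K; destruct H as (Ha & Hb & H), K as (Hc & Hd & K).
    apply height_verts in Ha, Hb; destruct E as [<- | <-]; lia.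
Qed.

Lemma blue_neq n x y : blue (halved_farey_stage n) x y -> x <> y.
Proof. intros H <-; exact (blue_oriented _ _ _ H H). Qed.

Lemma black_neq n x y : black (halved_farey_stage n) x y -> x <> y.
Proof.
  induction n as [|n IH]; simpl; [easy|].
  intros [H | H]; [auto | exact (blue_neq _ _ _ H)].
Qed.

Definition stage_edge (n : nat) (x y : label) : Prop :=
  blue (halved_farey_stage n) x y \/ black (halved_farey_stage n) x y.

Definition halved_farey : graph.
Proof.
  refine (Graph
    { x : label | exists n, verts (halved_farey_stage n) x }
    (fun x y => exists n, stage_edge n (proj1_sig x) (proj1_sig y) \/
                          stage_edge n (proj1_sig y) (proj1_sig x)) _ _).
  - intros x y [n [H | H]]; exists n; auto.
  - intros x [n [[H | H] | [H | H]]];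
      solve [exact (blue_neq _ _ _ H eq_refl) | exact (black_neq _ _ _ H eq_refl)].
Defined.

(* Main.v *)
(* Call two vertices linked in a set R of vertices if finitely many edges never
   separate them in the subgraph induced by R.  A star is an infinite set U with
   a centre to which every u in U stays linked after the deletion of any finite
   subset of U - u; the path systems of any countable graph can be chosen
   greedily on a star.

   If G has no star, then after the deletion of finitely many vertices every
   vertex remains linked to all but finitely many of its neighbours, and this
   property passes to the two sides of a vertex separating a linked pair.  Call
   a pair linear if every vertex linked to it separates it.  A linear pair
   splits at a vertex into two linear pairs whose regions share only that
   vertex, and iterating this immerses the halved Farey graph.

   If there is neither a star nor a linear pair, then a linked pair has only
   finitely many separating vertices: from infinitely many of them one would
   obtain a star, using one non-separating vertex in each of infinitely many
   parts.  But then a star around a fixed vertex can be built greedily from its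
   neighbours, a contradiction. *)
From Stdlib Require Import List Arith Lia Cantor Classical.
From Stdlib Require Import ClassicalEpsilon ProofIrrelevance.
Require Import Defs.
Import ListNotations.

(** * Paths as vertex lists *)

Lemma in_path_steps {V : Type} (p : list V) (x y : V) :
  In (x, y) (path_steps p) <-> exists l1 l2, p = l1 ++ x :: y :: l2.
Proof.
  unfold path_steps; split.
  - induction p as [|a [|b p] IH]; simpl; try easy.
    intros [[= -> ->] | H]; [now exists [], p|].
    destruct (IH H) as (l1 & l2 & E); exists (a :: l1), l2; simpl; now rewrite E.
  - intros (l1 & l2 & ->); induction l1 as [|a l1 IH]; simpl; [now left|].
    destruct l1; simpl in *; auto.
Qed.

Lemma in_path_steps_rev {V : Type} (p : list V) (x y : V) :
  In (x, y) (path_steps (rev p)) -> In (y, x) (path_steps p).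
Proof.
  rewrite !in_path_steps; intros (l1 & l2 & E).
  exists (rev l2), (rev l1).
  rewrite <- (rev_involutive p), E, rev_app_distr; simpl.
  now rewrite <- !app_assoc.
Qed.

Lemma uses_edge_rev {V : Type} (p : list V) (x y : V) :
  uses_edge (rev p) x y -> uses_edge p x y.
Proof. intros [H | H]; apply in_path_steps_rev in H; [now right | now left]. Qed.

Lemma uses_edge_in {V : Type} (p : list V) (x y : V) :
  uses_edge p x y -> In x p /\ In y p.
Proof.
  intros [H | H]; apply in_path_steps in H; destruct H as (l1 & l2 & ->);
    split; apply in_app_iff; simpl; auto.
Qed.

Lemma last_in {V : Type} (p : list V) (d : V) : p <> [] -> In (last p d) p.
Proof.
  induction p as [|a [|b p] IH]; [easy | now left |].
  intros _; right; now apply IH.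
Qed.

Lemma last_default {V : Type} (p : list V) (d d' : V) :
  p <> [] -> last p d = last p d'.
Proof.
  induction p as [|a [|b p] IH]; [easy | easy |].
  intros _; now apply IH.
Qed.

Lemma last_app_cons {V : Type} (p q : list V) (x d : V) :
  last (p ++ x :: q) d = last (x :: q) d.
Proof.
  induction p as [|a p IH]; [easy|]; rewrite <- IH; simpl.
  now destruct (p ++ x :: q) eqn:E; [destruct p|].
Qed.

Lemma is_path_ends {G : graph} {u v : G} {p : list G} :
  is_path G u v p -> In u p /\ In v p.
Proof.
  intros (H1 & H2 & _); destruct p as [|a p]; [easy|].
  injection H1 as ->; split; [now left|].
  rewrite <- H2; now apply last_in.
Qed.

Lemma is_path_rev {G : graph} {u v : G} {p : list G} :
  is_path G u v p -> is_path G v u (rev p).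
Proof.
  intros (H1 & H2 & H3 & H4).
  destruct p as [|a p]; [easy|]; injection H1 as ->.
  split; [|split; [|split]].
  - destruct (exists_last (l := u :: p)) as (q & z & E); [easy|].
    rewrite E, last_last in H2; subst z.
    now rewrite E, rev_app_distr.
  - simpl; now rewrite last_last.
  - now apply NoDup_rev.
  - intros x y H; apply adj_sym, H4; now apply in_path_steps_rev.
Qed.

(* Only one orientation of each edge needs a path; the other one is forced by
   [si_rev]. *)
Lemma oriented_immersion (H G : graph) (f : H -> G) (O : H -> H -> Prop)
    (P : H -> H -> list G) :
  (forall u v, adj H u v -> O u v \/ O v u) ->
  (forall u v, O u v -> ~ O v u) ->
  (forall x y, f x = f y -> x = y) ->
  (forall u v, O u v -> is_path G (f u) (f v) (P u v)) ->
  (forall u v u' v' a b, O u v -> O u' v' ->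
     uses_edge (P u v) a b -> uses_edge (P u' v') a b -> u = u' /\ v = v') ->
  (forall u v x, O u v -> In (f x) (P u v) -> x = u \/ x = v) ->
  strongly_immersed H G.
Proof.
  intros Htot Hanti Hinj Hpath Hdisj Hint.
  set (pth := fun u v =>
    if excluded_middle_informative (O u v) then P u v else rev (P v u)).
  assert (Hor : forall u v, adj H u v ->
    O u v /\ pth u v = P u v \/ O v u /\ pth u v = rev (P v u)).
  { intros u v A; unfold pth.
    destruct (excluded_middle_informative (O u v)); [now left|].
    destruct (Htot _ _ A); [easy | now right]. }
  exists f, pth; constructor.
  - exact Hinj.
  - intros u v A; destruct (Hor _ _ A) as [[HO ->] | [HO ->]]; auto using is_path_rev.
  - intros u v A; unfold pth.
    destruct (excluded_middle_informative (O u v)) as [HO | HO],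
      (excluded_middle_informative (O v u)) as [HO' | HO'].
    + now elim (Hanti _ _ HO).
    + reflexivity.
    + now rewrite rev_involutive.
    + now destruct (Htot _ _ A).
  - intros u v u' v' A A' N1 N2 a b [E E'].
    destruct (Hor _ _ A) as [[HO E1] | [HO E1]],
      (Hor _ _ A') as [[HO' E2] | [HO' E2]]; rewrite E1 in E; rewrite E2 in E';
      try apply uses_edge_rev in E; try apply uses_edge_rev in E';
      destruct (Hdisj _ _ _ _ _ _ HO HO' E E'); auto.
  - intros u v A z Hz Nu Nv x ->.
    destruct (Hor _ _ A) as [[HO E] | [HO E]]; rewrite E in Hz;
      [|apply in_rev in Hz]; destruct (Hint _ _ _ HO Hz); subst; auto.
Qed.

(** * Infinite edge-connectivity inside a set of vertices *)

Definition without {V : Type} (R : V -> Prop) (Y : list V) : V -> Prop :=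
  fun x => R x /\ ~ In x Y.

Definition whole {V : Type} : V -> Prop := fun _ => True.

Definition infinite_set {V : Type} (P : V -> Prop) : Prop :=
  forall L : list V, exists x, P x /\ ~ In x L.

Definition step {G : graph} (R : G -> Prop) (S : list (G * G)) (x y : G) : Prop :=
  adj G x y /\ R x /\ R y /\ ~ In (x, y) S /\ ~ In (y, x) S.

(** The walk of no steps is allowed at every [x], even outside [R]; hence [linked] asks separately
    that both ends lie in [R]. *)
Inductive reach {G : graph} (R : G -> Prop) (S : list (G * G)) (x : G) : G -> Prop :=
| reach_refl : reach R S x x
| reach_snoc y z : reach R S x y -> step R S y z -> reach R S x z.

Definition linked {G : graph} (R : G -> Prop) (a b : G) : Prop :=
  R a /\ R b /\ forall S, reach R S a b.

Section Reach.
Context {G : graph}.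
Implicit Types (R Q : G -> Prop) (S : list (G * G)) (x y z a b v w : G)
  (Y L : list G).

Lemma step_sym R S x y : step R S x y -> step R S y x.
Proof. intros (A & B & C & D & E); repeat split; auto using adj_sym. Qed.

Lemma reach_trans R S x y z : reach R S x y -> reach R S y z -> reach R S x z.
Proof. intros H K; induction K; eauto using reach_snoc. Qed.

Lemma reach_sym R S x y : reach R S x y -> reach R S y x.
Proof.
  induction 1 as [|y z _ IH H]; [constructor|].
  apply reach_trans with y; [|exact IH].
  eapply reach_snoc; [constructor | now apply step_sym].
Qed.

Lemma reach_mono R R' S S' x y :
  (forall z, R z -> R' z) -> incl S' S -> reach R S x y -> reach R' S' x y.
Proof.
  intros HR HS; induction 1 as [|y z _ IH (A & B & C & D & E)]; [constructor|].
  apply reach_snoc with y; [exact IH|]; repeat split; auto.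
Qed.

Lemma reach_in R S x y : reach R S x y -> x = y \/ R y.
Proof. intros [|? ? _ (_ & _ & H & _)]; auto. Qed.

Lemma reach_inside R S x y :
  reach R S x y -> reach (fun z => R z /\ reach R S x z) S x y.
Proof.
  induction 1 as [|y z H IH K]; [constructor|].
  apply reach_snoc with y; [exact IH|].
  assert (reach R S x z) by eauto using reach_snoc.
  destruct K as (A & B & C & D); repeat split; tauto.
Qed.

(** Follow the walk up to its first visit to [v]: until then it stays in the component of [x]
    without [v]. *)
Lemma first_hit R S v x y : x <> v -> reach R S x y ->
  reach (without R [v]) S x y \/
  reach (fun z => R z /\ (z = v \/ reach (without R [v]) S x z)) S x v.
Proof.
  intros Hx; induction 1 as [|y z _ IH K]; [left; constructor|].
  destruct IH as [IH | IH]; [|now right].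
  assert (Hy : y <> v).
  { destruct (reach_in _ _ _ _ IH) as [<- | [_ H]]; [exact Hx|].
    intros ->; apply H; now left. }
  destruct K as (A & B & C & D).
  destruct (classic (z = v)) as [-> | Hz].
  - right; apply reach_snoc with y.
    + refine (reach_mono _ _ _ _ _ _ _ (incl_refl _) (reach_inside _ _ _ _ IH)).
      unfold without; tauto.
    + repeat split; tauto.
  - left; apply reach_snoc with y; [exact IH|].
    repeat split; try tauto; intros [<- | []]; auto.
Qed.

Lemma reach_path R S x y : reach R S x y ->
  exists p, is_path (delete_edges G S) x y p /\ forall z, In z p -> z = y \/ R z.
Proof.
  intros H; apply reach_sym in H; induction H as [|x' x _ IH K].
  - exists [y]; split; [|now intros z [<- | []]; left].
    repeat split; simpl; try easy.
    constructor; [easy | constructor].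
  - destruct IH as (p & (P1 & P2 & P3 & P4) & P5).
    destruct K as (A & _ & B & C & D).
    (* If [x] already lies on the path, the part of the path from [x] on serves instead. *)
    destruct (classic (In x p)) as [Hx | Hx].
    + apply in_split in Hx; destruct Hx as (l1 & l2 & ->).
      exists (x :: l2); split; [split; [|split; [|split]]|].
      * reflexivity.
      * rewrite <- P2, last_app_cons; now apply last_default.
      * clear - P3; induction l1; simpl in *; [easy|]; inversion P3; auto.
      * intros s t H; apply P4; rewrite in_path_steps in *.
        destruct H as (k1 & k2 & E); exists (l1 ++ k1), k2.
        now rewrite E, <- app_assoc.
      * intros z Hz; apply P5; apply in_app_iff; now right.
    + exists (x :: p); split; [split; [|split; [|split]]|].
      * reflexivity.
      * destruct p as [|a p]; [easy|]; rewrite <- P2; now apply (last_default (_ :: p)).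
      * now constructor.
      * intros s t H; destruct p as [|a p]; [easy|].
        injection P1 as ->; destruct H as [[= <- <-] | H]; [|now apply P4].
        repeat split; auto using adj_sym.
      * intros z [<- | Hz]; auto.
Qed.

Lemma path_reach S x y p :
  is_path (delete_edges G S) x y p -> reach whole S x y.
Proof.
  intros (P1 & P2 & _ & P4); revert x P1 P2.
  induction p as [|a p IH]; [easy|]; intros x [= ->] P2.
  destruct p as [|b p]; [simpl in P2; subst; constructor|].
  apply reach_trans with b.
  - destruct (P4 x b) as (A & B & C); [now left|].
    eapply reach_snoc; [constructor|]; repeat split; auto.
  - apply IH; auto.
    + intros s t H; apply P4; now right.
    + rewrite <- P2; now apply (last_default (_ :: p)).
Qed.

Lemma linked_sym R a b : linked R a b -> linked R b a.
Proof. intros (A & B & C); repeat split; auto using reach_sym. Qed.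

Lemma linked_trans R a b c : linked R a b -> linked R b c -> linked R a c.
Proof. intros (A & B & C) (A' & B' & C'); repeat split; eauto using reach_trans. Qed.

Lemma linked_mono R R' a b :
  (forall z, R z -> R' z) -> linked R a b -> linked R' a b.
Proof.
  intros H (A & B & C); repeat split; auto.
  intros S; eapply reach_mono; eauto using incl_refl.
Qed.

Lemma not_linked R a b : R a -> R b -> ~ linked R a b -> exists S, ~ reach R S a b.
Proof.
  intros A B H; apply NNPP; intros K; apply H; repeat split; auto.
  intros S; apply NNPP; intros N; apply K; now exists S.
Qed.

(** Once all edges from [a] to [L] are deleted, a walk from [b] can enter [a] only from a neighbour
    outside [L]. *)
Lemma linked_neighbours R a b : linked R a b -> a <> b ->
  infinite_set (fun w => adj G a w /\ R w).
Proof.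
  intros (_ & _ & H) N L; specialize (H (map (pair a) L)).
  apply reach_sym in H; inversion H as [|w ? _ K]; [subst; easy|].
  destruct K as (A & B & _ & _ & D); exists w; repeat split; auto using adj_sym.
  intros K; apply D; now apply in_map.
Qed.

Lemma linked_join R1 R2 R a v b :
  (forall z, R1 z -> R z) -> (forall z, R2 z -> R z) ->
  linked R1 a v -> linked R2 v b -> linked R a b.
Proof. eauto using linked_trans, linked_mono. Qed.

End Reach.

(** * Stars *)

(** Dependent choice for greedy constructions: each choice sees the list of all earlier ones, oldest
    first. *)
Lemma history_choice {A : Type} (P : list A -> A -> Prop) :
  (forall l, exists x, P l x) ->
  exists f : nat -> A, forall n, P (map f (seq 0 n)) (f n).
Proof.
  intros H.
  set (g := fun l => proj1_sig (constructive_indefinite_description _ (H l))).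
  set (h := fix h n := match n with 0 => [] | S n => h n ++ [g (h n)] end).
  exists (fun n => g (h n)); intros n.
  replace (map _ _) with (h n).
  - unfold g; apply proj2_sig.
  - induction n as [|n IH]; [easy|].
    now rewrite seq_S, map_app, <- IH.
Qed.

Definition star_at {G : graph} (U : G -> Prop) (h : G) : Prop :=
  forall u Z, U u -> (forall z, In z Z -> U z) -> ~ In u Z ->
  linked (without whole Z) u h.

Definition has_star (G : graph) : Prop :=
  exists (h : G) (U : G -> Prop), infinite_set U /\ star_at U h.

(** Greedy construction of a star: [I] is an invariant of the finite approximations, which are
    listed newest first. The limit is a star because every finite [Z] is contained in one
    approximation. *)
Lemma star_of_extensions {G : graph} (h : G) (I : list G -> Prop) :
  I [] ->
  (forall l, I l -> exists v, ~ In v l /\ I (v :: l)) ->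
  (forall l v, I l -> In v l -> linked (fun x => In x l -> x = v) v h) ->
  has_star G.
Proof.
  intros I0 IS Ih.
  destruct (history_choice (fun l v => I (rev l) -> ~ In v l /\ I (v :: rev l)))
    as (f & Hf).
  { intros l; destruct (classic (I (rev l))) as [Hl | Hl]; [|now exists h].
    destruct (IS _ Hl) as (v & Hv & K); exists v; intros _; split; [|exact K].
    now rewrite in_rev. }
  set (pre := fun n => map f (seq 0 n)).
  assert (HI : forall n, I (rev (pre n))).
  { induction n as [|n IH]; [exact I0|].
    unfold pre; rewrite seq_S, map_app, rev_app_distr.
    now apply Hf. }
  assert (Hin : forall n x, In x (rev (pre n)) <-> exists i, i < n /\ x = f i).
  { intros n x; rewrite <- in_rev; unfold pre; rewrite in_map_iff.
    split; intros (i & H1 & H2); exists i; rewrite in_seq in *; split; auto with arith.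
    lia. }
  assert (Hnew : forall i n, i < n -> f n <> f i).
  { intros i n Hi E; destruct (Hf n) as [K _]; [apply HI|].
    apply K; rewrite in_rev; apply Hin; now exists i. }
  exists h, (fun x => exists n, x = f n); split.
  - intros L; apply NNPP; intros N.
    assert (ND : NoDup (pre (S (length L)))).
    { unfold pre; apply NoDup_map_NoDup_ForallPairs; [|apply seq_NoDup].
      intros i j _ _ E; destruct (Nat.lt_trichotomy i j) as [K | [K | K]];
        [| exact K |]; now elim (Hnew _ _ K). }
    assert (K : incl (pre (S (length L))) L).
    { intros x Hx; apply NNPP; intros Nx; apply N; exists x; split; [|exact Nx].
      rewrite in_rev in Hx; apply Hin in Hx; destruct Hx as (i & _ & ->); eauto. }
    apply NoDup_incl_length in K; [|exact ND].
    unfold pre in K; rewrite length_map, length_seq in K; lia.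
  - intros u Z [n ->] HZ Hn.
    assert (exists m, n < m /\ forall z, In z Z -> In z (rev (pre m))) as (m & Hm & K).
    { clear Hn; induction Z as [|z Z IH]; [exists (S n); split; [lia | easy]|].
      destruct IH as (m & Hm & K); [intros; apply HZ; now right|].
      destruct (HZ z) as (i & ->); [now left|].
      exists (S (m + i)); split; [lia|].
      intros z [<- | Hz]; apply Hin; [exists i; split; [lia | easy]|].
      apply K, Hin in Hz; destruct Hz as (j & Hj & ->); exists j; split; [lia | easy]. }
    apply linked_mono with (fun x => In x (rev (pre m)) -> x = f n).
    + intros z Hz; split; [easy|]; intros Kz; apply Hn.
      rewrite <- (Hz (K _ Kz)); exact Kz.
    + apply Ih; [apply HI | apply Hin; now exists n].
Qed.

(** * Richness *)

Lemma finite_union {A B : Type} (P : A -> B -> Prop) (l : list A) :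
  (forall z, In z l -> exists L, forall w, P z w -> In w L) ->
  exists L, forall z, In z l -> forall w, P z w -> In w L.
Proof.
  induction l as [|a l IH]; intros H; [now exists []|].
  destruct (H a) as [La Ha]; [now left|].
  destruct IH as [L HL]; [intros z Hz; apply H; now right|].
  exists (La ++ L); intros z [<- | Hz] w Hw; apply in_app_iff; eauto.
Qed.

Lemma not_infinite {A : Type} (P : A -> Prop) :
  ~ infinite_set P -> exists L, forall x, P x -> In x L.
Proof.
  intros H; apply NNPP; intros K; apply H; intros L.
  apply NNPP; intros N; apply K; exists L; intros x Hx.
  apply NNPP; intros Nx; apply N; eauto.
Qed.

Lemma list_minus {A : Type} (l : list A) (x : A) :
  exists l', forall z, In z l' <-> In z l /\ z <> x.
Proof.
  exists (remove (fun x y => excluded_middle_informative (x = y)) x l).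
  intros z; split; [apply in_remove | intros []; now apply in_in_remove].
Qed.

(** The property derived from the absence of stars, relative to [Q]: the finite set [Y] is deleted,
    and [L] holds the exceptional neighbours. *)
Definition rich {G : graph} (Q : G -> Prop) : Prop :=
  forall Y a, Q a -> ~ In a Y -> exists L, forall w,
  adj G a w -> Q w -> ~ In w Y -> ~ In w L -> linked (without Q Y) w a.

Section Rich.
Context {G : graph}.
Implicit Types (R Q : G -> Prop) (S : list (G * G)) (x y z a b v w h : G)
  (Y Z L l : list G).

(* An edge cut between [v] and [a] in [R - y] also keeps the paths from [v] to
   [y] away from [Z] until they meet [y]. *)
Lemma linked_cutvertex R v a y Z :
  linked R v a -> R y -> v <> y -> a <> y -> ~ linked (without R [y]) v a ->
  (forall z, In z Z -> R z /\ z <> y /\ ~ linked (without R [y]) v z) ->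
  ~ In v Z ->
  linked (without R Z) v y.
Proof.
  intros (Rv & Ra & Hva) Ry Ny Na Hsep HZ NvZ.
  assert (W : forall x, R x -> x <> y -> without R [y] x).
  { intros x Rx Nx; split; [exact Rx|]; intros [<- | []]; auto. }
  (* The finitely many edge cuts that keep [v] from [a] and from [Z] are merged into one. *)
  assert (exists S, forall z, In z (a :: Z) -> ~ reach (without R [y]) S v z)
    as (S0 & HS0).
  { assert (K : forall z, In z (a :: Z) -> R z /\ z <> y /\ ~ linked (without R [y]) v z).
    { intros z [<- | Hz]; auto. }
    clear HZ; induction (a :: Z) as [|z l IH]; [now exists []|].
    destruct IH as (S1 & H1); [intros; apply K; now right|].
    destruct (K z) as (Rz & Nz & Lz); [now left|].
    apply not_linked in Lz; auto; destruct Lz as (S2 & H2).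
    exists (S1 ++ S2); intros t [<- | Ht] Kt.
    - apply H2; revert Kt; apply reach_mono; [easy | apply incl_appr, incl_refl].
    - apply (H1 _ Ht); revert Kt; apply reach_mono; [easy | apply incl_appl, incl_refl]. }
  split; [now split|]; split.
  { split; [exact Ry|]; intros K; now destruct (HZ _ K) as (_ & K' & _). }
  intros S; destruct (first_hit R (S ++ S0) y v a) as [K | K]; auto.
  - exfalso; apply (HS0 a); [now left|].
    revert K; apply reach_mono; [easy | apply incl_appr, incl_refl].
  - revert K; apply reach_mono; [|apply incl_appl, incl_refl].
    intros z [Rz Hz]; split; [exact Rz|]; intros Kz.
    destruct Hz as [-> | Hz]; [now destruct (HZ _ Kz) as (_ & K' & _)|].
    apply (HS0 z); [now right|].
    revert Hz; apply reach_mono; [easy | apply incl_appr, incl_refl].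
Qed.

(** Each [w] in [W] offers an edge into [a], and a finite set of edges cannot contain all of
    these. *)
Lemma linked_of_infinite_neighbours R (W : G -> Prop) z a :
  R z -> R a -> infinite_set W ->
  (forall w, W w -> adj G a w /\ linked R w z) -> linked R z a.
Proof.
  intros Rz Ra HW H; split; [exact Rz|]; split; [exact Ra|]; intros S.
  destruct (HW (map fst S ++ map snd S)) as (w & Ww & Nw).
  destruct (H _ Ww) as (A & Rw & _ & K).
  apply reach_snoc with w; [apply reach_sym, K|].
  rewrite in_app_iff, !in_map_iff in Nw.
  repeat split; auto using adj_sym; intros E; apply Nw;
    [left; now exists (w, a) | right; now exists (a, w)].
Qed.

(** Induction on the deleted vertices. If deleting one more vertex [y] cut off infinitely many
    neighbours from [a], then [y] would be the centre of a star on such neighbours, chosen pairwise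
    unlinked. *)
Lemma rich_whole : infinitely_edge_connected G -> ~ has_star G -> rich (@whole G).
Proof.
  intros [_ HG] NS Y.
  induction Y as [|y Y IH]; intros a _ Na.
  { exists []; intros w A _ _ _; split; [now split|]; split; [now split|].
    intros S; destruct (HG w a) with (S := S) as (p & Hp).
    - intros ->; now apply adj_irrefl in A.
    - apply path_reach in Hp; revert Hp; apply reach_mono; [now split | apply incl_refl]. }
  destruct (IH a) as (L & HL); [easy | intros K; apply Na; now right |].
  destruct (classic (In y Y)) as [Hy | Hy].
  { exists L; intros w A _ Nw NL; apply linked_mono with (without whole Y).
    - intros z [_ Hz]; split; [easy|]; intros [<- | K]; auto.
    - apply HL; auto; [easy | intros K; apply Nw; now right]. }
  assert (a <> y) by (intros ->; apply Na; now left).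
  set (R := without (@whole G) (y :: Y)).
  set (W := fun w => adj G a w /\ ~ In w (y :: Y) /\ ~ In w L /\ ~ linked R w a).
  destruct (classic (infinite_set W)) as [HW | HW].
  2:{ apply not_infinite in HW; destruct HW as (L' & HL').
      exists (L' ++ L); intros w A _ Nw NL; rewrite in_app_iff in NL.
      apply NNPP; intros K; apply NL; left; apply HL'; repeat split; auto. }
  exfalso; apply NS.
  assert (HR : forall x, R x <-> without (without whole Y) [y] x).
  { intros x; unfold R, without, whole; simpl; tauto. }
  apply star_of_extensions with y (fun l =>
    (forall w, In w l -> W w) /\
    forall w w', In w l -> In w' l -> w <> w' -> ~ linked R w w').
  - now split.
  - intros l [HlW Hl].
    (* A chosen [z] is linked to only finitely many members of [W], since infinitely many would link
       it to [a]. *)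
    destruct (finite_union (fun z w => W w /\ linked R w z) l) as (L' & HL').
    { intros z Hz; apply not_infinite; intros K.
      destruct (HlW _ Hz) as (_ & Nz & _ & Lz); apply Lz.
      apply linked_of_infinite_neighbours with (3 := K); try (now split).
      intros w [(A & _) Hw]; now split. }
    destruct (HW (L' ++ l)) as (v & Wv & Nv); rewrite in_app_iff in Nv.
    exists v; split; [tauto|]; split.
    + intros w [<- | Hw]; auto.
    + assert (K : forall w, In w l -> ~ linked R v w).
      { intros w Hw Lw; apply Nv; left; eauto. }
      intros w w' [<- | Hw] [<- | Hw'] N; auto.
      intros Lw; apply (K w Hw); now apply linked_sym.
  - intros l v [HlW Hl] Hv.
    destruct (HlW _ Hv) as (A & Nv & NL & Sv); simpl in Nv.
    destruct (list_minus l v) as (Z & HZ).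
    apply linked_mono with (without (without whole Y) Z).
    { intros z [_ Kz] Hz; rewrite HZ in Kz; apply NNPP; tauto. }
    (* Before the deletion of [y] the vertex [v] was linked to [a], so its connections pass through
       [y]. *)
    apply linked_cutvertex with a; [| | |assumption| | |].
    + apply HL; auto; easy.
    + split; auto; easy.
    + intros ->; apply Nv; now left.
    + intros K; apply Sv; revert K; apply linked_mono; intros x; apply HR.
    + intros z Hz; apply HZ in Hz; destruct Hz as [Hz Nz].
      destruct (HlW _ Hz) as (_ & Nz' & _); simpl in Nz'.
      repeat split; auto; intros K; apply (Hl v z); auto.
      revert K; apply linked_mono; intros x; apply HR.
    + intros K; apply HZ in K; tauto.
Qed.

(** The region is [v] together with the component of [a] in [Q] without [v] and [S]. Deleting [S] as
    well keeps walks in this component until they meet [v]. At a vertex other than [v], richness is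
    applied with [v] deleted too, and [v] counts as exceptional. *)
Lemma rich_side Q S v a : rich Q -> Q v -> Q a -> a <> v ->
  rich (fun z => Q z /\ (z = v \/ reach (without Q [v]) S a z)).
Proof.
  intros HQ Qv Qa Nav Y b [Qb Hb] Nb.
  destruct (classic (b = v)) as [-> | Nbv].
  - destruct (HQ Y v) as (L & HL); auto.
    exists L; intros w A [Qw Hw] NwY NwL.
    destruct Hw as [-> | Hw]; [now apply adj_irrefl in A|].
    split; [split; [split|]; auto|]; split; [split; [split|]; auto|]; intros S'.
    destruct (HL w A Qw NwY NwL) as (_ & _ & K); specialize (K (S ++ S')).
    assert (Nw : w <> v) by (intros ->; now apply adj_irrefl in A).
    assert (Incl : incl S (S ++ S')) by (apply incl_appl, incl_refl).
    apply first_hit with (v := v) in K; [|exact Nw]; destruct K as [K | K].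
    + apply reach_in in K; destruct K as [K | [_ K]]; [easy|].
      elim K; now left.
    + revert K; apply reach_mono; [|apply incl_appr, incl_refl].
      intros z [[Qz Nz] Hz]; split; [split; [exact Qz|] | exact Nz].
      destruct Hz as [Hz | Hz]; [now left|right].
      apply reach_trans with w; [exact Hw|]; revert Hz.
      apply reach_mono; [|exact Incl]; unfold without; tauto.
  - destruct Hb as [Hb | Hb]; [easy|].
    destruct (HQ (v :: Y) b) as (L & HL); auto.
    { intros [K | K]; auto. }
    exists (v :: L); intros w A [Qw Hw] NwY NwL; simpl in NwL.
    destruct Hw as [Hw | Hw]; [elim NwL; now left|].
    split; [split; [split|]; auto|]; split; [split; [split|]; auto|]; intros S'.
    destruct (HL w A Qw) as (_ & _ & K); [intros [E | E]; auto | auto |].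
    specialize (K (S ++ S')); apply reach_inside in K; revert K.
    apply reach_mono; [|apply incl_appr, incl_refl].
    intros z [[Qz Nz] Hz]; split; [split; [exact Qz | right] | intros K; apply Nz; now right].
    apply reach_trans with w; [exact Hw|]; revert Hz; apply reach_mono.
    + unfold without; simpl; tauto.
    + apply incl_appl, incl_refl.
Qed.

(** Since [S] separates [a] from [b] off [v], a walk avoiding [S] must meet [v], and up to there it
    stays on the side of [a]. *)
Lemma linked_side Q S v a b : linked Q a b -> Q v -> a <> v ->
  ~ reach (without Q [v]) S a b ->
  linked (fun z => Q z /\ (z = v \/ reach (without Q [v]) S a z)) a v.
Proof.
  intros (Qa & Qb & K) Qv N Hab.
  split; [split; [exact Qa | right; constructor]|]; split; [auto|]; intros S'.
  specialize (K (S ++ S')); apply first_hit with (v := v) in K; [|exact N].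
  destruct K as [K | K].
  - elim Hab; revert K; apply reach_mono; [easy | apply incl_appl, incl_refl].
  - revert K; apply reach_mono; [|apply incl_appr, incl_refl].
    intros z [Qz [Hz | Hz]]; split; auto; right; revert Hz.
    apply reach_mono; [easy | apply incl_appl, incl_refl].
Qed.

Lemma split_region Q a b v : rich Q -> linked Q a b -> Q v -> v <> a -> v <> b ->
  ~ linked (without Q [v]) a b ->
  exists R1 R2,
    (rich R1 /\ linked R1 a v /\ ~ R1 b /\ forall z, R1 z -> Q z) /\
    (rich R2 /\ linked R2 v b /\ ~ R2 a /\ forall z, R2 z -> Q z) /\
    forall z, R1 z -> R2 z -> z = v.
Proof.
  intros HQ Hab Qv Na Nb Hsep.
  assert (H := Hab); destruct H as (Qa & Qb & _).
  assert (W : forall x, Q x -> v <> x -> without Q [v] x).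
  { intros x Qx Nx; split; [exact Qx|]; intros [E | []]; auto. }
  (* The same cut [S] defines both sides; a common vertex other than [v] would yield a walk from [a]
     to [b]. *)
  destruct (not_linked (without Q [v]) a b) as (S & HS); auto.
  assert (HS' : ~ reach (without Q [v]) S b a).
  { intros K; now apply HS, reach_sym. }
  exists (fun z => Q z /\ (z = v \/ reach (without Q [v]) S a z)),
    (fun z => Q z /\ (z = v \/ reach (without Q [v]) S b z)).
  split; [|split].
  - split; [now apply rich_side; auto|]; split; [now apply linked_side with b; auto|].
    split; [|tauto]; intros [_ [K | K]]; auto.
  - split; [now apply rich_side; auto|]; split.
    { apply linked_sym, linked_side with a; auto using linked_sym. }
    split; [|tauto]; intros [_ [K | K]]; auto.
  - intros z [_ [E | K]] [_ [E' | K']]; auto.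
    elim HS; apply reach_trans with z; [exact K | now apply reach_sym].
Qed.

(** * Separators of a linked pair *)

Definition separator Q a b v : Prop :=
  Q v /\ v <> a /\ v <> b /\ ~ linked (without Q [v]) a b.

(** Richness is included so that the two parts of a split can be split again. *)
Definition linear_pair Q a b : Prop :=
  rich Q /\ a <> b /\ linked Q a b /\
  forall v, linked Q v a -> v <> a -> v <> b -> separator Q a b v.

Lemma linear_pair_sym Q a b : linear_pair Q a b -> linear_pair Q b a.
Proof.
  intros (H1 & H2 & H3 & H4); split; [exact H1|]; split; [auto|].
  split; [now apply linked_sym|]; intros v Lv Nb Na.
  destruct (H4 v) as (K1 & K2 & K3 & K4); auto.
  - apply linked_trans with b; auto using linked_sym.
  - repeat split; auto; intros K; now apply K4, linked_sym.
Qed.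

(** If [w] did not separate [a] from [v] in [R1], continuing from [v] to [b] through [R2], which
    misses [w], would show that [w] does not separate [a] from [b] in [Q]. *)
Lemma linear_pair_part Q R1 R2 a b v : linear_pair Q a b -> rich R1 ->
  (forall z, R1 z -> Q z) -> (forall z, R2 z -> Q z) ->
  (forall z, R1 z -> R2 z -> z = v) ->
  linked R1 a v -> linked R2 v b -> ~ R1 b -> v <> a ->
  linear_pair R1 a v.
Proof.
  intros (H1 & H2 & H3 & H4) HR S1 S2 I L1 L2 Nb Nv.
  split; [exact HR|]; split; [auto|]; split; [exact L1|].
  intros w Lw Na Nw; assert (K := Lw); destruct K as (Rw & _).
  repeat split; auto; intros K.
  destruct (H4 w) as (_ & _ & _ & N).
  - revert Lw; now apply linked_mono.
  - exact Na.
  - intros ->; auto.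
  - apply N; apply linked_join with (3 := K) (4 := L2).
    + intros z [Rz Nz]; split; auto.
    + intros z Rz; split; auto; intros [<- | []]; auto.
Qed.

(** By richness some neighbour [v] of [a] outside [T] is linked to [a], and linearity makes it a
    separator. In both parts the new vertex [v] comes second, as an apex does in the blue edges at
    it. *)
Lemma linear_pair_split Q a b T : linear_pair Q a b ->
  exists v R1 R2, Q v /\ ~ In v T /\ v <> a /\ v <> b /\
    linear_pair R1 a v /\ linear_pair R2 b v /\
    (forall z, R1 z -> Q z) /\ (forall z, R2 z -> Q z) /\
    (forall z, R1 z -> R2 z -> z = v) /\ ~ R1 b /\ ~ R2 a.
Proof.
  intros H; assert (K := H); destruct K as (HQ & N & Hab & HL).
  assert (Qa : Q a) by apply Hab.
  destruct (HQ [] a Qa) as (L & HL'); [easy|].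
  destruct (linked_neighbours _ _ _ Hab N (L ++ b :: T)) as (v & (A & Qv) & Nv).
  rewrite in_app_iff in Nv; simpl in Nv.
  assert (Na : v <> a) by (intros ->; now apply adj_irrefl in A).
  assert (Nb : v <> b) by (intros ->; tauto).
  assert (Lv : linked Q v a).
  { apply linked_mono with (without Q []); [now intros z []|].
    apply HL'; auto. }
  destruct (HL v Lv Na Nb) as (_ & _ & _ & Hsep).
  destruct (split_region Q a b v HQ Hab Qv Na Nb Hsep)
    as (R1 & R2 & (A1 & A2 & A3 & A4) & (B1 & B2 & B3 & B4) & C).
  exists v, R1, R2; repeat (split; [now auto|]); split; [|split; [|now auto 6]].
  - now apply linear_pair_part with Q R2 b.
  - apply linear_pair_part with Q R1 a; auto using linear_pair_sym, linked_sym.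
Qed.

Lemma separator_sym Q a b v : separator Q a b v -> separator Q b a v.
Proof.
  intros (H1 & H2 & H3 & H4); repeat split; auto.
  intros K; now apply H4, linked_sym.
Qed.

(* [l] collects star vertices outside the region [R], in which [x] and [y] are
   the ends.  They stay linked to the centre [c] as long as the vertices [X]
   still to be chosen inside [R] do not separate [x] from [y] there. *)
Definition partial_star c l R x y : Prop :=
  rich R /\ x <> y /\ linked R x y /\ infinite_set (separator R x y) /\
  (forall z, In z l -> ~ R z) /\
  forall X : G -> Prop, (forall z, X z -> R z /\ z <> x /\ z <> y) ->
  linked (fun z => R z /\ ~ X z) x y ->
  linked (fun z => ~ In z l /\ ~ X z) x c /\
  linked (fun z => ~ In z l /\ ~ X z) y c /\
  forall v, In v l -> linked (fun z => (In z l -> z = v) /\ ~ X z) v c.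

Lemma partial_star_sym c l R x y : partial_star c l R x y -> partial_star c l R y x.
Proof.
  intros (H1 & H2 & H3 & H4 & H5 & H6); split; [exact H1|]; split; [auto|].
  split; [now apply linked_sym|]; split.
  { intros L; destruct (H4 L) as (v & Hv & Nv); exists v; split; [|exact Nv].
    now apply separator_sym. }
  split; [exact H5|]; intros X HX HL.
  destruct (H6 X) as (K1 & K2 & K3); auto using linked_sym.
  intros z Hz; destruct (HX z Hz); tauto.
Qed.

(** The region shrinks to [N], and [K] is left behind to supply the new star vertex [v]. It reaches
    the centre through [w] and [y], while a passage through [K] around [v] keeps the older star
    vertices linked to the centre. *)
Lemma partial_star_extend c l R x y w N K :
  (forall Q a b, ~ linear_pair Q a b) ->
  partial_star c l R x y ->
  rich N -> linked N x w -> x <> w -> ~ N y -> (forall z, N z -> R z) ->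
  infinite_set (separator N x w) ->
  rich K -> linked K w y -> w <> y -> ~ K x -> (forall z, K z -> R z) ->
  (forall z, N z -> K z -> z = w) ->
  exists v, ~ In v l /\ partial_star c (v :: l) N x w.
Proof.
  intros NL (H1 & H2 & H3 & H4 & H5 & H6) HN LN Nxw Ny NR IN HK LK Nwy Nx KR NK.
  (* Such a [v] exists because [w] and [y] are not a linear pair in [K]. *)
  assert (exists v, K v /\ v <> w /\ v <> y /\ linked K v w /\
            linked (without K [v]) w y) as (v & Kv & Vw & Vy & Lvw & Lwy).
  { apply NNPP; intros F; apply (NL K w y).
    repeat split; auto; try apply LK; try apply H.
    intros L; apply F; exists v; repeat split; auto; try apply H; apply L. }
  exists v; split; [intros Hl; apply (H5 v); auto|].
  split; [exact HN|]; split; [exact Nxw|]; split; [exact LN|]; split; [exact IN|].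
  split.
  { intros z [<- | Hz] Nz; [apply Vw; auto | apply (H5 z); auto]. }
  intros X' HX' LX'.
  assert (KX : forall z, K z -> ~ X' z).
  { intros z Kz Xz; destruct (HX' z Xz) as (Nz & _ & F); apply F; auto. }
  assert (Kl : forall z, K z -> ~ In z l).
  { intros z Kz Hz; apply (H5 z); auto. }
  (* For the old star vertices, [v] counts as one of the vertices chosen inside [R]. *)
  set (X := fun z => X' z \/ z = v).
  assert (KvX : forall z, without K [v] z -> K z /\ ~ X z).
  { intros z [Kz Nz]; split; [exact Kz|]; intros [F | ->]; [now apply (KX z)|].
    apply Nz; now left. }
  assert (Avoid : forall z, ~ In z l /\ ~ X z -> ~ In z (v :: l) /\ ~ X' z).
  { unfold X; intros z [A B]; split; [intros [<- | F]; auto | auto]. }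
  destruct (H6 X) as (Kx & Ky & Kl').
  { intros z [Xz | ->].
    - destruct (HX' z Xz) as (Nz & F & F'); repeat split; auto; now intros ->.
    - repeat split; auto; now intros ->. }
  { apply linked_join with (3 := LX') (4 := Lwy).
    - intros z [Nz Xz]; split; [auto|]; intros [F | ->]; [auto|].
      apply Vw; auto.
    - intros z Kz; apply KvX in Kz; split; [apply KR|]; apply Kz. }
  assert (Kw : linked (fun z => ~ In z (v :: l) /\ ~ X' z) w c).
  { apply linked_join with (3 := Lwy) (4 := Ky); auto.
    intros z Kz; apply KvX in Kz; apply Avoid; split; [apply Kl|]; apply Kz. }
  split; [now apply linked_mono with (2 := Kx)|].
  split; [exact Kw|].
  intros u [<- | Hu].
  - apply linked_join with (3 := Lvw) (4 := Kw).
    + intros z Kz; split; auto; intros [<- | F]; [easy|]; now apply Kl in F.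
    + intros z [A B]; split; [|exact B]; intros F; now elim A.
  - apply linked_mono with (2 := Kl' u Hu); intros z [A B].
    unfold X in B; split; [intros [<- | F]; auto; now elim B; right | auto].
Qed.

(* When no linear pair exists, splitting repeatedly at separators while keeping
   infinitely many of them leaves behind one part at every step, and each such
   part contains a vertex whose deletion keeps its two ends linked; these
   vertices form a star. *)
Lemma star_of_separators Q a b :
  (forall Q a b, ~ linear_pair Q a b) ->
  rich Q -> a <> b -> linked Q a b -> infinite_set (separator Q a b) ->
  has_star G.
Proof.
  intros NL HQ Nab Hab HW.
  apply star_of_extensions with a (fun l => exists R x y, partial_star a l R x y).
  - exists Q, a, b; repeat (split; [easy|]); intros X _ (A & B & C).
    split; [|split; [|easy]].
    + repeat split; try easy; try apply A; constructor.
    + apply linked_mono with (fun z => Q z /\ ~ X z); [now intros z []|].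
      now apply linked_sym.
  - intros l (R & x & y & HR).
    assert (HR' := HR); destruct HR' as (H1 & H2 & H3 & H4 & _).
    destruct (H4 []) as (w & (Rw & Nx & Ny & Sw) & _).
    destruct (split_region R x y w H1 H3 Rw Nx Ny Sw)
      as (R1 & R2 & (A1 & A2 & A3 & A4) & (B1 & B2 & B3 & B4) & C).
    destruct (classic (infinite_set (separator R1 x w))) as [HI | HI].
    + destruct (partial_star_extend a l R x y w R1 R2) as (v & Hv & Kv); auto.
      exists v; split; [exact Hv|]; now exists R1, x, w.
    + destruct (partial_star_extend a l R y x w R2 R1) as (v & Hv & Kv);
        auto using partial_star_sym, linked_sym.
      (* Apart from [w] and finitely many others, a separator [t] of [x] and [y] does not separate
         [x] from [w] in [R1], so it must separate [w] from [y] in [R2]. *)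
      * apply not_infinite in HI; destruct HI as (L1 & HL1); intros L.
        destruct (H4 (w :: L1 ++ L)) as (t & (Rt & Tx & Ty & St) & Nt).
        simpl in Nt; rewrite in_app_iff in Nt.
        exists t; split; [|tauto].
        assert (K1 : linked (without R1 [t]) x w).
        { apply NNPP; intros K.
          apply Nt; right; left; apply HL1; repeat split; auto.
          apply NNPP; intros F; apply K; revert A2; apply linked_mono.
          intros z Rz; split; [exact Rz|]; intros [<- | []]; auto. }
        assert (K2 : ~ linked (without R2 [t]) w y).
        { intros K; apply St; apply linked_join with (3 := K1) (4 := K);
            intros z [Rz Nz]; split; auto. }
        repeat split; auto.
        { apply NNPP; intros F; apply K2; revert B2; apply linked_mono.
          intros z Rz; split; [exact Rz|]; intros [<- | []]; auto. }
        intros K; now apply K2, linked_sym.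
      * exists v; split; [exact Hv|]; now exists R2, y, w.
  - intros l v (R & x & y & H1 & H2 & H3 & H4 & H5 & H6) Hv.
    destruct (H6 (fun _ => False)) as (_ & _ & K); [easy | |].
    + revert H3; apply linked_mono; auto.
    + apply linked_mono with (2 := K v Hv); now intros z [].
Qed.

(** The next star vertex is a neighbour of [a] outside three finite lists: the separators between
    earlier star vertices and [a], the neighbours not linked to [a] after the deletion of [l], and
    [l] itself. *)
Lemma linear_pair_or_star : infinitely_edge_connected G -> ~ has_star G ->
  exists Q a b, linear_pair Q a b.
Proof.
  intros HG NS; apply NNPP; intros NL.
  assert (NL' : forall Q a b, ~ linear_pair Q a b) by (intros Q a b K; eauto).
  assert (HV := rich_whole HG NS); assert (HG' := HG).
  destruct HG' as [(a & b & Nab) HG'].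
  apply NS, star_of_extensions with a (fun l => ~ In a l /\
    forall u, In u l -> linked (fun x => In x l -> x = u) u a).
  - now split.
  - intros l [Hl HI].
    destruct (finite_union (fun u => separator (fun x => In x l -> x = u) u a) l)
      as (L & HL).
    { intros u Hu; apply not_infinite; intros K; apply NS.
      apply star_of_separators with (5 := K); auto; [|intros ->; auto].
      (* Deleting the star vertices other than [u] preserves richness: they are simply added to the
         deleted set. *)
      destruct (list_minus l u) as (Z & HZ); intros Y x Qx Nx.
      destruct (HV (Z ++ Y) x) as (L & HL); [easy | |].
      { rewrite in_app_iff, HZ; intros [[]|]; auto. }
      exists L; intros w A Qw NY NwL.
      apply linked_mono with (without whole (Z ++ Y)).
      - intros z [_ Hz]; rewrite in_app_iff, HZ in Hz; split; [|tauto].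
        intros K'; apply NNPP; tauto.
      - apply HL; auto; [easy|]; rewrite in_app_iff, HZ; intros [[]|]; auto. }
    destruct (HV l a) as (L' & HL'); [easy | exact Hl |].
    destruct (linked_neighbours whole a b) with (L := L ++ L' ++ l)
      as (w & (A & _) & Nw); auto.
    { repeat split; intros S; destruct (HG' a b Nab S) as (p & Hp).
      now apply path_reach in Hp. }
    rewrite !in_app_iff in Nw.
    assert (Na : w <> a) by (intros ->; now apply adj_irrefl in A).
    assert (Lw : linked (without whole l) w a) by (apply HL'; tauto || easy).
    exists w; split; [tauto|]; split; [intros [E | K]; auto|].
    intros u [<- | Hu].
    + revert Lw; apply linked_mono; intros z [_ Nz] [<- | K]; [easy|].
      now elim Nz.
    + apply linked_mono with (without (fun x => In x l -> x = u) [w]).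
      * intros z [Hz Nz] [<- | K]; [|auto]; elim Nz; now left.
      * apply NNPP; intros K; apply Nw; left; apply (HL u Hu).
        repeat split; auto; [intros F | intros ->]; tauto.
  - now intros l v [_ H] Hv; auto.
Qed.

End Rich.

(** * Immersing a countable graph at a star *)

Lemma linked_path {G : graph} (R : G -> Prop) (a b : G) (S : list (G * G)) :
  linked R a b ->
  exists p, is_path G a b p /\ (forall z, In z p -> R z) /\
    forall x y, uses_edge p x y -> ~ In (x, y) S /\ ~ In (y, x) S.
Proof.
  intros (_ & Rb & H); destruct (reach_path _ _ _ _ (H S)) as (p & (P1 & P2 & P3 & P4) & P5).
  exists p; split; [|split].
  - split; [exact P1|]; split; [exact P2|]; split; [exact P3|].
    intros x y K; now apply P4.
  - intros z Hz; destruct (P5 z Hz) as [-> | K]; auto.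
  - intros x y [K | K]; apply P4 in K; destruct K as (_ & K & K'); auto.
Qed.

Lemma nth_map_seq {A : Type} (f : nat -> A) (n i : nat) (d : A) :
  i < n -> nth i (map f (seq 0 n)) d = f i.
Proof.
  intros H; rewrite nth_indep with (d' := f 0) by now rewrite length_map, length_seq.
  now rewrite map_nth, seq_nth.
Qed.

(** Stage [n] picks a fresh star vertex and, if [n] codes the pair [(i, j)], a path between the star
    vertices number [i] and [j] that avoids the others chosen so far. Such a path exists because
    both ends are linked to the centre. *)
Lemma star_immersion (H G : graph) (code : H -> nat) :
  (forall x y, code x = code y -> x = y) -> has_star G -> strongly_immersed H G.
Proof.
  intros Hcode (h & U & HU & Hh).
  set (used := flat_map (fun e : G * list G => fst e :: snd e)).
  destruct (history_choice (fun l (e : G * list G) =>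
    let fs := map fst l ++ [fst e] in
    let (i, j) := of_nat (length l) in
    let a := nth i fs h in let b := nth j fs h in
    U (fst e) /\ ~ In (fst e) (used l) /\
    ((forall z, In z fs -> U z) -> In a fs -> In b fs -> a <> b ->
     is_path G a b (snd e) /\
     (forall z, In z (snd e) -> In z fs -> z = a \/ z = b) /\
     forall x y, uses_edge (snd e) x y -> ~ (In x (used l) /\ In y (used l)))))
    as (f & Hf).
  { intros l; destruct (HU (used l)) as (u & Uu & Nu).
    destruct (of_nat (length l)) as [i j].
    set (fs := map fst l ++ [u]); set (a := nth i fs h); set (b := nth j fs h).
    destruct (classic ((forall z, In z fs -> U z) /\ In a fs /\ In b fs /\ a <> b))
      as [(K1 & K2 & K3 & K4) | K].
    2:{ exists (u, []); simpl; fold fs a b; tauto. }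
    destruct (list_minus fs a) as (Z1 & HZ1), (list_minus Z1 b) as (Z & HZ).
    assert (L : linked (without whole Z) a b).
    { apply linked_trans with h; [|apply linked_sym].
      - apply Hh; auto.
        + intros z Hz; apply HZ in Hz; destruct Hz as [Hz _].
          apply HZ1 in Hz; now apply K1.
        + rewrite HZ, HZ1; tauto.
      - apply Hh; auto.
        + intros z Hz; apply HZ in Hz; destruct Hz as [Hz _].
          apply HZ1 in Hz; now apply K1.
        + rewrite HZ; tauto. }
    (* All edges with both ends used are forbidden, in particular those of the earlier paths. *)
    destruct (linked_path _ _ _ (list_prod (used l) (used l)) L) as (p & P1 & P2 & P3).
    exists (u, p); simpl; fold fs a b; split; [exact Uu|]; split; [exact Nu|].
    intros _ _ _ _; split; [exact P1|]; split.
    - intros z Hz Hz'; destruct (P2 z Hz) as [_ N]; rewrite HZ, HZ1 in N.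
      apply NNPP; tauto.
    - intros x y E [Ex Ey]; apply P3 in E; destruct E as [E _].
      now apply E, in_prod. }
  set (v := fun n => fst (f n)); set (p := fun n => snd (f n)).
  assert (Hfs : forall n, map fst (map f (seq 0 n)) ++ [fst (f n)] = map v (seq 0 (S n))).
  { intros n; rewrite seq_S, map_app, map_map; reflexivity. }
  assert (Hused : forall n x, In x (used (map f (seq 0 n))) <->
            exists k, k < n /\ (x = v k \/ In x (p k))).
  { intros n x; unfold used; rewrite in_flat_map; split.
    - intros (e & He & Hx); apply in_map_iff in He; destruct He as (k & <- & Hk).
      apply in_seq in Hk; exists k; split; [lia|].
      destruct Hx as [<- | Hx]; auto.
    - intros (k & Hk & Hx); exists (f k); split; [apply in_map, in_seq; lia|].
      destruct Hx as [-> | Hx]; [now left | now right]. }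
  assert (Hv : forall n, U (v n) /\ ~ In (v n) (used (map f (seq 0 n)))).
  { intros n; specialize (Hf n); destruct (of_nat _); split; apply Hf. }
  assert (Hlt : forall i j, i < j -> v i <> v j).
  { intros i j Hij E; apply (Hv j), Hused; exists i; split; auto. }
  assert (Hinj : forall i j, v i = v j -> i = j).
  { intros i j E; destruct (Nat.lt_trichotomy i j) as [K | [K | K]]; auto;
      [now elim (Hlt _ _ K) | now elim (Hlt _ _ K)]. }
  assert (Hp : forall i j, i < j -> let n := to_nat (i, j) in
    j <= n /\ is_path G (v i) (v j) (p n) /\
    (forall k, k <= n -> In (v k) (p n) -> k = i \/ k = j) /\
    forall x y, uses_edge (p n) x y ->
      ~ (In x (used (map f (seq 0 n))) /\ In y (used (map f (seq 0 n))))).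
  { intros i j Hij n.
    (* The code of a pair is at least each of its entries, so both ends are already chosen at stage
       [n]. *)
    assert (Hn : j <= n) by (pose proof (to_nat_non_decreasing i j); lia).
    specialize (Hf n); rewrite length_map, length_seq in Hf.
    rewrite (cancel_of_to (i, j) : of_nat n = (i, j)) in Hf.
    destruct Hf as (_ & _ & Hf); rewrite Hfs in Hf.
    rewrite !nth_map_seq in Hf by lia.
    destruct Hf as (P1 & P2 & P3).
    - intros z Hz; apply in_map_iff in Hz; destruct Hz as (k & <- & _); apply Hv.
    - apply in_map, in_seq; lia.
    - apply in_map, in_seq; lia.
    - now apply Hlt.
    - split; [exact Hn|]; split; [exact P1|]; split; [|exact P3].
      intros k Hk K; destruct (P2 _ K); auto; apply in_map, in_seq; lia. }
  apply oriented_immersion with (f := fun x => v (code x))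
    (O := fun x y => code x < code y) (P := fun x y => p (to_nat (code x, code y))).
  - intros x y A; destruct (Nat.lt_trichotomy (code x) (code y)) as [K | [K | K]]; auto.
    apply Hcode in K; subst; now apply adj_irrefl in A.
  - intros; lia.
  - intros x y E; auto.
  - intros x y K; now apply (Hp _ _ K).
  - intros x y x' y' a b K K' E E'.
    assert (En : to_nat (code x, code y) = to_nat (code x', code y')).
    { destruct (Nat.lt_trichotomy (to_nat (code x, code y)) (to_nat (code x', code y')))
        as [L | [L | L]]; [exfalso | exact L | exfalso].
      - apply (Hp _ _ K') in E'; apply E'; apply uses_edge_in in E.
        split; apply Hused; eexists; (split; [exact L|]); right; apply E.
      - apply (Hp _ _ K) in E; apply E; apply uses_edge_in in E'.
        split; apply Hused; eexists; (split; [exact L|]); right; apply E'. }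
    apply (f_equal of_nat) in En; rewrite !cancel_of_to in En.
    injection En; auto.
  - intros x y z K Kz; destruct (Hp _ _ K) as (_ & _ & P & _).
    destruct (P (code z)) as [E | E]; auto.
    (* A star vertex chosen after the path is fresh and so does not lie on it. *)
    apply NNPP; intros N; apply (Hv (code z)), Hused.
    exists (to_nat (code x, code y)); split; [lia | now right].
Qed.

(** * Immersing the halved Farey graph between a linear pair *)

(** A linear pair standing for a blue edge; [used] accumulates the vertices of the routes of the
    edges that it descends from. *)
Record state (G : graph) : Type := State {
  region : G -> Prop;
  src : G;
  tgt : G;
  used : list G;
  linear : linear_pair region src tgt
}.
Arguments region {G}. Arguments src {G}. Arguments tgt {G}. Arguments used {G}.
Arguments linear {G}.

(** One step at a blue edge: a route for the edge itself, and a split at the image [mid] of its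
    apex. The route may cross both parts; [mid] avoids it, and [used] keeps the routes of
    descendants off its edges. *)
Record refinement {G : graph} (s : state G) : Type := Refinement {
  route : list G;
  mid : G;
  left_part : state G;
  right_part : state G;
  route_path : is_path G (src s) (tgt s) route;
  route_region : forall z, In z route -> region s z;
  route_unused : forall x y, uses_edge route x y -> ~ (In x (used s) /\ In y (used s));
  mid_region : region s mid;
  mid_unused : ~ In mid (route ++ used s);
  left_src : src left_part = src s;
  left_tgt : tgt left_part = mid;
  left_used : used left_part = route ++ used s;
  left_region : forall z, region left_part z -> region s z;
  left_tgt_out : ~ region left_part (tgt s);
  right_src : src right_part = tgt s;
  right_tgt : tgt right_part = mid;
  right_used : used right_part = route ++ used s;
  right_region : forall z, region right_part z -> region s z;
  right_src_out : ~ region right_part (src s);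
  parts_meet : forall z, region left_part z -> region right_part z -> z = mid
}.
Arguments route {G s}. Arguments mid {G s}.
Arguments left_part {G s}. Arguments right_part {G s}.

Lemma refinement_exists {G : graph} (s : state G) : inhabited (refinement s).
Proof.
  destruct (linear s) as (_ & _ & L & _).
  destruct (linked_path _ _ _ (list_prod (used s) (used s)) L) as (p & P1 & P2 & P3).
  destruct (linear_pair_split _ _ _ (p ++ used s) (linear s))
    as (v & R1 & R2 & Qv & Nv & _ & _ & L1 & L2 & S1 & S2 & I & O1 & O2).
  constructor.
  refine (Refinement G s p v (State G R1 (src s) v (p ++ used s) L1)
    (State G R2 (tgt s) v (p ++ used s) L2) P1 P2 _ Qv Nv _ _ _ S1 O1 _ _ _ S2 O2 I);
    try reflexivity.
  intros x y E [Ex Ey]; apply P3 in E; destruct E as [E _].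
  now apply E, in_prod.
Qed.

(** One fixed refinement for each state, so that the points, routes and parts read off from it
    belong together. *)
Definition refine_state {G : graph} (s : state G) : refinement s :=
  epsilon (refinement_exists s) (fun _ => True).

Lemma label_eq_dec (x y : label) : {x = y} + {x <> y}.
Proof. decide equality; apply Bool.bool_dec. Defined.

(* [edge_state s0 x y] is the state of the blue edge [xy]; except for the
   initial edge, [y] is the apex of the blue edge whose half [xy] is. *)
Fixpoint edge_state {G : graph} (s0 : state G) (x y : label) : state G :=
  match y with
  | base _ => s0
  | apex p q =>
      if label_eq_dec x p then left_part (refine_state (edge_state s0 p q))
      else right_part (refine_state (edge_state s0 p q))
  end.

Definition point {G : graph} (s0 : state G) (x : label) : G :=
  match x with
  | base false => src s0
  | base true => tgt s0
  | apex p q => mid (refine_state (edge_state s0 p q))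
  end.

Definition edge_route {G : graph} (s0 : state G) (x y : label) : list G :=
  route (refine_state (edge_state s0 x y)).

Notation stage_blue n := (blue (halved_farey_stage n)).
Notation stage_verts n := (verts (halved_farey_stage n)).

Lemma stage_verts_mono n m x : n <= m -> stage_verts n x -> stage_verts m x.
Proof. induction 1; [easy | left; auto]. Qed.

(** The heights of its ends determine the stage at which an edge is blue, so both stages agree. *)
Lemma blue_stage_oriented n m x y : stage_blue n x y -> ~ stage_blue m y x.
Proof.
  intros H K; assert (n = m) as <-.
  { apply height_blue in H, K; destruct H as (_ & _ & H), K as (_ & _ & K).
    simpl in *; lia. }
  now apply (blue_oriented _ _ _ H).
Qed.

Lemma verts_new n z : stage_verts n z ->
  stage_verts 0 z \/ exists k x y, stage_blue k x y /\ z = apex x y.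
Proof.
  induction n as [|n IH]; [now left|].
  intros [H | (x & y & H & ->)].
  - destruct (IH H) as [K | (k & x & y & K)]; [now left|].
    right; now exists k, x, y.
  - right; exists n, x, y; auto.
Qed.

Lemma edge_black n x y : black (halved_farey_stage n) x y -> exists m, stage_blue m x y.
Proof.
  induction n as [|n IH]; [easy|]; intros [H | H]; eauto.
Qed.

(** Every black edge was blue at some stage. *)
Lemma adj_halved_farey (u v : halved_farey) : adj halved_farey u v <->
  exists n, stage_blue n (proj1_sig u) (proj1_sig v) \/
            stage_blue n (proj1_sig v) (proj1_sig u).
Proof.
  split.
  - intros [n [[H | H] | [H | H]]]; try apply edge_black in H; eauto;
      destruct H as [m H]; eauto.
  - intros [n [H | H]]; exists n; [left | right]; now left.
Qed.

Section Farey.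
Context {G : graph} (s0 : state G).

Notation st := (edge_state s0).
Notation f := (point s0).

Lemma edge_state_ends n x y :
  stage_blue n x y -> src (st x y) = f x /\ tgt (st x y) = f y.
Proof.
  revert x y; induction n as [|n IH]; [now intros x y [-> ->]|].
  intros a z (x & y & H & -> & Ha); simpl.
  destruct (IH _ _ H) as [IH1 IH2].
  destruct (label_eq_dec a x) as [-> | N].
  - rewrite left_src, left_tgt; auto.
  - rewrite right_src, right_tgt; destruct Ha; [easy | subst a; auto].
Qed.

Lemma region_ends n x y : stage_blue n x y ->
  region (st x y) (f x) /\ region (st x y) (f y) /\ f x <> f y.
Proof.
  intros H; destruct (edge_state_ends _ _ _ H) as [<- <-].
  destruct (linear (st x y)) as (_ & N & (A & B & _) & _); auto.
Qed.

Lemma apex_point n x y : stage_blue n x y ->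
  region (st x y) (f (apex x y)) /\
  f (apex x y) <> f x /\ f (apex x y) <> f y.
Proof.
  intros H; destruct (edge_state_ends _ _ _ H) as [<- <-]; simpl.
  set (r := refine_state (st x y)); split; [apply mid_region|].
  assert (E := is_path_ends (route_path _ r)).
  split; intros K; apply (mid_unused _ r), in_app_iff; left; rewrite K; apply E.
Qed.

Lemma half_region n x y a : stage_blue n x y -> a = x \/ a = y ->
  (forall w, region (st a (apex x y)) w -> region (st x y) w) /\
  (forall z, z = x \/ z = y -> region (st a (apex x y)) (f z) -> z = a) /\
  used (st a (apex x y)) = edge_route s0 x y ++ used (st x y).
Proof.
  intros H Ha; destruct (edge_state_ends _ _ _ H) as [E1 E2]; simpl.
  unfold edge_route; set (r := refine_state (st x y)).
  destruct (label_eq_dec a x) as [-> | N].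
  - split; [apply left_region|]; split; [|apply left_used].
    intros z [-> | ->]; [easy|]; intros K.
    rewrite <- E2 in K; now apply left_tgt_out in K.
  - destruct Ha as [Ha | ->]; [easy|].
    split; [apply right_region|]; split; [|apply right_used].
    intros z [-> | ->]; [|easy]; intros K.
    rewrite <- E1 in K; now apply right_src_out in K.
Qed.

(** The three parts need each other in the induction. Halves of different edges can meet only at the
    image of a common old end, because a half omits the opposite end of its edge; the two halves of
    one edge meet only at the apex. *)
Lemma stage_invariant n :
  (forall x y x' y' w, stage_blue n x y -> stage_blue n x' y' ->
     region (st x y) w -> region (st x' y') w -> ~ (x = x' /\ y = y') ->
     exists z, (z = x \/ z = y) /\ (z = x' \/ z = y') /\ w = f z) /\
  (forall x y z, stage_blue n x y -> stage_verts n z ->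
     region (st x y) (f z) -> z = x \/ z = y) /\
  (forall z z', stage_verts n z -> stage_verts n z' -> f z = f z' -> z = z').
Proof.
  induction n as [|n (I1 & I2 & I3)].
  { assert (N : f (base false) <> f (base true)).
    { apply (region_ends 0 (base false) (base true)); now split. }
    split; [|split].
    - intros x y x' y' w [-> ->] [-> ->] _ _ F; now elim F.
    - intros x y z [-> ->] [[|] ->]; auto.
    - intros z z' [[|] ->] [[|] ->] E; auto; now elim N. }
  (* The image of an apex differs from the images of the ends of its edge, so it lies in no other
     region of this stage. *)
  assert (New : forall x y x' y', stage_blue n x y -> stage_blue n x' y' ->
            region (st x y) (f (apex x' y')) -> x = x' /\ y = y').
  { intros x y x' y' H H' K; apply NNPP; intros N.
    destruct (apex_point _ _ _ H') as (A1 & A2 & A3).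
    destruct (I1 _ _ _ _ _ H H' K A1 N) as (z & _ & [-> | ->] & E); auto. }
  split; [|split].
  - intros a p a' p' w (x & y & H & -> & Ha) (x' & y' & H' & -> & Ha') K K' N.
    destruct (half_region _ _ _ _ H Ha) as (R1 & R2 & _).
    destruct (half_region _ _ _ _ H' Ha') as (R1' & R2' & _).
    destruct (classic (x = x' /\ y = y')) as [[<- <-] | N'].
    + exists (apex x y); split; [now right|]; split; [now right|]; simpl in *.
      destruct (label_eq_dec a x) as [-> | D], (label_eq_dec a' x) as [-> | D'].
      * now elim N.
      * eapply parts_meet; eauto.
      * eapply parts_meet; eauto.
      * destruct Ha; [easy|]; destruct Ha'; [easy|]; subst; now elim N.
    + destruct (I1 _ _ _ _ w H H' (R1 _ K) (R1' _ K') N') as (z & Hz & Hz' & ->).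
      assert (z = a) as -> by now apply R2.
      assert (a = a') as -> by now apply R2'.
      exists a'; auto.
  - intros a p z (x & y & H & -> & Ha) Hz K.
    destruct (half_region _ _ _ _ H Ha) as (R1 & R2 & _).
    destruct Hz as [Hz | (x' & y' & H' & ->)].
    + left; apply R2; [|exact K]; now apply (I2 x y); auto.
    + right; destruct (New x y x' y') as [-> ->]; auto.
  - assert (Mix : forall z x y, stage_verts n z -> stage_blue n x y -> f z <> f (apex x y)).
    { intros z x y Hz H E; destruct (apex_point _ _ _ H) as (A1 & A2 & A3).
      destruct (I2 x y z) as [-> | ->]; auto; now rewrite E. }
    intros z z' [Hz | (x & y & H & ->)] [Hz' | (x' & y' & H' & ->)] E.
    + auto.
    + now elim (Mix _ _ _ Hz H').
    + now elim (Mix _ _ _ Hz' H).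
    + destruct (New x y x' y') as [-> ->]; auto.
      rewrite <- E; now apply (apex_point n).
Qed.

Lemma point_inj n m z z' : stage_verts n z -> stage_verts m z' -> f z = f z' -> z = z'.
Proof.
  intros H H'; apply (stage_invariant (max n m));
    [revert H | revert H']; apply stage_verts_mono; lia.
Qed.

(** Allows edges of different stages to be compared at the earlier one: descending shrinks regions
    and adds routes to [used]. *)
Lemma blue_ancestor n m x y : n <= m -> stage_blue m x y ->
  exists x' y', stage_blue n x' y' /\
    (forall w, region (st x y) w -> region (st x' y') w) /\
    (n = m /\ x' = x /\ y' = y \/ n < m /\ incl (edge_route s0 x' y') (used (st x y))).
Proof.
  intros Hnm; revert x y; induction Hnm as [|m Hnm IH]; intros x y H.
  { exists x, y; auto 6. }
  destruct H as (p & q & H & -> & Hx).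
  destruct (IH _ _ H) as (x' & y' & H' & R & Hu).
  destruct (half_region _ _ _ _ H Hx) as (R1 & _ & E).
  exists x', y'; split; [exact H'|]; split; [auto|]; right; split; [lia|].
  rewrite E; destruct Hu as [(_ & -> & ->) | [_ Hu]].
  - apply incl_appl, incl_refl.
  - now apply incl_appr.
Qed.

Lemma edge_route_region x y z : In z (edge_route s0 x y) -> region (st x y) z.
Proof. apply route_region. Qed.

Lemma route_internal n m x y z : stage_blue n x y -> stage_verts m z ->
  In (f z) (edge_route s0 x y) -> z = x \/ z = y.
Proof.
  intros H Hz K; assert (R := edge_route_region _ _ _ K).
  destruct (stage_invariant n) as (I1 & I2 & _).
  destruct (verts_new _ _ Hz) as [Hz' | (k & p & q & Hpq & ->)].
  { apply I2; auto; apply stage_verts_mono with (2 := Hz'); lia. }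
  destruct (le_lt_dec n k) as [L | L].
  2:{ apply I2; auto; apply stage_verts_mono with (S k); [lia|].
      right; now exists p, q. }
  (* An apex born later avoids the routes of its ancestors by choice of [mid]. If [xy] is not an
     ancestor, the image lies in two regions of stage [n], hence is the image of a vertex of that
     stage, against freshness. *)
  exfalso; destruct (blue_ancestor _ _ _ _ L Hpq) as (x' & y' & H' & R' & Hu).
  destruct (apex_point _ _ _ Hpq) as (A1 & _).
  destruct (classic (x = x' /\ y = y')) as [[<- <-] | N].
  - apply (mid_unused _ (refine_state (st p q))), in_app_iff.
    destruct Hu as [(_ & -> & ->) | [_ Hu]]; [left; exact K | right; apply Hu, K].
  - destruct (I1 _ _ _ _ _ H H' R (R' _ A1) N) as (t & Ht & _ & E).
    assert (Vt : stage_verts n t).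
    { apply height_blue in H; destruct Ht; subst t; apply H. }
    assert (apex p q = t) as <-.
    { eapply point_inj; [exact Hz | exact Vt | exact E]. }
    apply (apex_fresh _ _ _ Hpq); now apply stage_verts_mono with n.
Qed.

(** A proper descendant avoids the edges of the route of [xy] through [used]. Otherwise a shared
    edge lies in two regions of stage [n], so its ends are the images of two common ends, which
    forces the blue edges to coincide. *)
Lemma routes_disjoint n m x y x' y' a b : stage_blue n x y -> stage_blue m x' y' ->
  n <= m -> uses_edge (edge_route s0 x y) a b -> uses_edge (edge_route s0 x' y') a b ->
  x = x' /\ y = y'.
Proof.
  intros H H' L E E'.
  destruct (blue_ancestor _ _ _ _ L H') as (p & q & Hpq & R & Hu).
  assert (F := uses_edge_in _ _ _ E); assert (F' := uses_edge_in _ _ _ E').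
  destruct (classic (x = p /\ y = q)) as [[<- <-] | N].
  { destruct Hu as [Hu | [_ Hu]]; [tauto|].
    elim (route_unused _ (refine_state (st x' y')) _ _ E'); split; apply Hu, F. }
  exfalso; destruct (stage_invariant n) as (I1 & _).
  assert (Hab : a <> b).
  { intros <-; destruct (route_path _ (refine_state (st x y))) as (_ & _ & _ & K).
    destruct E as [E | E]; apply K in E; now apply adj_irrefl in E. }
  destruct (I1 _ _ _ _ a H Hpq) as (s & Hs & Hs' & ->); auto.
  { now apply edge_route_region. }
  { apply R; now apply edge_route_region. }
  destruct (I1 _ _ _ _ b H Hpq) as (t & Ht & Ht' & ->); auto.
  { now apply edge_route_region. }
  { apply R; now apply edge_route_region. }
  assert (s <> t) by (intros ->; auto).
  assert (O := blue_oriented _ _ _ H).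
  destruct Hs, Ht; subst s t; try easy; destruct Hs', Ht'; subst; auto; congruence.
Qed.

Lemma halved_farey_immersion : strongly_immersed halved_farey G.
Proof.
  apply oriented_immersion with (f := fun x => f (proj1_sig x))
    (O := fun x y => exists n, stage_blue n (proj1_sig x) (proj1_sig y))
    (P := fun x y => edge_route s0 (proj1_sig x) (proj1_sig y)).
  - intros u v A; apply adj_halved_farey in A; destruct A as [n [A | A]]; eauto.
  - intros u v [n H] [m K]; now apply (blue_stage_oriented _ _ _ _ H) in K.
  - intros [x [n Hx]] [y [m Hy]] E; apply subset_eq_compat.
    now apply (point_inj n m).
  - intros u v [n H]; destruct (edge_state_ends _ _ _ H) as [<- <-].
    apply route_path.
  - intros [u Hu] [v Hv] [u' Hu'] [v' Hv'] a b [n H] [m H'] E E'; simpl in *.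
    assert (u = u' /\ v = v') as [-> ->].
    { destruct (le_lt_dec n m) as [L | L].
      - now apply (routes_disjoint n m _ _ _ _ a b).
      - destruct (routes_disjoint m n u' v' u v a b); auto; lia. }
    split; apply subset_eq_compat; reflexivity.
  - intros [u Hu] [v Hv] [x [m Hx]] [n H] K; simpl in *.
    destruct (route_internal n m u v x) as [-> | ->]; auto;
      [left | right]; apply subset_eq_compat; reflexivity.
Qed.

End Farey.

(** * Infinite edge-connectivity of the halved Farey graph *)

(** Witnesses the countability that [star_immersion] requires. *)
Fixpoint label_code (x : label) : nat :=
  match x with
  | base b => if b then 1 else 0
  | apex p q => 2 + to_nat (label_code p, label_code q)
  end.

Lemma label_code_inj x y : label_code x = label_code y -> x = y.
Proof.
  revert y; induction x as [b | p IHp q IHq]; intros [b' | p' q'];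
    cbn [label_code]; intros E.
  - destruct b, b'; congruence.
  - destruct b; lia.
  - destruct b'; lia.
  - apply Nat.succ_inj, Nat.succ_inj, (f_equal of_nat) in E.
    rewrite !cancel_of_to in E.
    injection E as E1 E2; f_equal; auto.
Qed.

(** The blue edges of a single stage connect all its vertices: the next stage replaces a blue edge
    by a blue path of length two through its apex. *)
Lemma blue_connected (E : label -> label -> Prop) n x y :
  (forall a b, E a b -> E b a) ->
  (forall a b c, E a b -> E b c -> E a c) ->
  (forall a, E a a) ->
  (forall a b, stage_blue n a b -> E a b) ->
  stage_verts n x -> stage_verts n y -> E x y.
Proof.
  intros Es Et Er; revert x y; induction n as [|n IH]; intros x y HE.
  - assert (E (base false) (base true)) by (apply HE; now split).
    intros [[|] ->] [[|] ->]; auto.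
  - assert (HE' : forall a b, stage_blue n a b -> E a (apex a b) /\ E b (apex a b)).
    { intros a b H; split; apply HE; exists a, b; auto. }
    assert (Old : forall x y, stage_verts n x -> stage_verts n y -> E x y).
    { intros a b; apply IH; intros c d H; destruct (HE' _ _ H); eauto. }
    assert (K : forall z, stage_verts (S n) z -> exists t, stage_verts n t /\ E z t).
    { intros z [H | (a & b & H & ->)]; [eauto|].
      exists a; split; [now apply height_blue in H | apply Es, HE', H]. }
    intros Hx Hy; destruct (K _ Hx) as (s & Hs & Es'), (K _ Hy) as (t & Ht & Et').
    eauto.
Qed.

Lemma halved_farey_connected : infinitely_edge_connected halved_farey.
Proof.
  assert (B : forall b, exists n, stage_verts n (base b)) by (intros b; exists 0, b; easy).
  split.
  { exists (exist _ (base false) (B false)), (exist _ (base true) (B true)).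
    intros K; apply (f_equal (@proj1_sig _ _)) in K; discriminate. }
  intros [u [i Hu]] [v [j Hv]] _ S.
  set (hs := fun e : halved_farey * halved_farey =>
    max (height (proj1_sig (fst e))) (height (proj1_sig (snd e)))).
  assert (exists N, forall e, In e S -> hs e <= N) as (N & HN).
  { induction S as [|e S (N & HN)]; [now exists 0|].
    exists (max (hs e) N); intros e' [<- | K]; [lia|]; apply HN in K; lia. }
  (* Every blue edge of stage [n] has an end of height [n], above all ends of deleted edges, so it
     survives. *)
  set (n := Datatypes.S (max N (max i j))).
  (* The clause [x = y] gives reflexivity also at labels that are not vertices. *)
  set (E := fun x y => x = y \/ exists Hx Hy,
    reach whole S (exist _ x Hx : halved_farey) (exist _ y Hy)).
  assert (K : E u v).
  { apply blue_connected with n; unfold E.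
    - intros a b [-> | (Ha & Hb & K)]; [now left|].
      right; exists Hb, Ha; now apply reach_sym.
    - intros a b c [-> | (Ha & Hb & K)]; [auto|].
      intros [<- | (Hb' & Hc & K')]; right; [now exists Ha, Hb|].
      exists Ha, Hc; apply reach_trans with (exist _ b Hb); [exact K|].
      now replace Hb with Hb' by apply proof_irrelevance.
    - now left.
    - intros a b H; right.
      assert (H' := H); apply height_blue in H'; destruct H' as (Va & Vb & _).
      exists (ex_intro _ n Va), (ex_intro _ n Vb).
      assert (Hn : height b = n).
      { destruct H as (p & q & H & -> & _); now apply height_blue in H. }
      apply reach_snoc with (exist _ a (ex_intro _ n Va)); [constructor|].
      split; [apply adj_halved_farey; exists n; now left|].
      split; [easy|]; split; [easy|].
      split; intros F; apply HN in F; unfold hs in F; simpl in F; lia.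
    - apply stage_verts_mono with (2 := Hu); lia.
    - apply stage_verts_mono with (2 := Hv); lia. }
  assert (R : reach whole S (exist _ u (ex_intro _ i Hu) : halved_farey)
                (exist _ v (ex_intro _ j Hv))).
  { destruct K as [<- | (Ha & Hb & K)].
    - replace (ex_intro _ j Hv) with (ex_intro (fun n => stage_verts n u) i Hu)
        by apply proof_irrelevance; constructor.
    - replace (ex_intro _ i Hu) with Ha by apply proof_irrelevance.
      now replace (ex_intro _ j Hv) with Hb by apply proof_irrelevance. }
  apply reach_path in R; destruct R as (p & R & _); eauto.
Qed.

(** * Universality of the halved Farey graph and uniqueness up to equivalence *)

Lemma halved_farey_immersed (G : graph) :
  infinitely_edge_connected G -> strongly_immersed halved_farey G.
Proof.
  intros HG; destruct (classic (has_star G)) as [HS | HS].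
  - apply star_immersion with (fun x => label_code (proj1_sig x)); [|exact HS].
    intros [x Hx] [y Hy] E; apply subset_eq_compat; now apply label_code_inj.
  - destruct (linear_pair_or_star HG HS) as (Q & a & b & L).
    exact (halved_farey_immersion (State G Q a b [] L)).
Qed.

Theorem theorem1 :
  infinitely_edge_connected halved_farey /\
  (forall G : graph,
     infinitely_edge_connected G -> strongly_immersed halved_farey G) /\
  (forall H : graph,
     infinitely_edge_connected H ->
     (forall G : graph, infinitely_edge_connected G -> strongly_immersed H G) ->
     immersion_equivalent H halved_farey).
Proof.
  split; [exact halved_farey_connected|]; split; [exact halved_farey_immersed|].
  intros H HH HU; split.
  - apply HU, halved_farey_connected.
  - now apply halved_farey_immersed.
Qed.
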